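(* Satisfiability of terms of $\mathrm{GRA}(e,p,s,I,\neg,\exists)$ can be checked by a finite automaton, i.e., the set of satisfiable terms of $\mathrm{GRA}(e,p,s,I,\neg,\exists)$ is in $\textsc{REG}$ (the class of regular languages).
   Context: AD-relations. $A^0=\{\epsilon\}$, with $\epsilon$ the empty tuple. A $k$-ary AD-relation over a set $A$ is a pair $(R,k)$ with $R\subseteq A^k$, $k\ge 0$; $t\in(R,k)$ means $t\in R$. Vocabularies contain only relation symbols (of any arity $k\ge 0$, countably infinitely many available for each arity). Models have nonempty domains; $A$ is the domain of $\mathfrak{A}$. Terms. $\mathrm{GRA}(e,p,s,I,\neg,\exists)$ is the set of terms built from relation symbols and the constant $e$ by the unary operators $p,s,I,\neg,\exists$; so each term has the form $f_1\cdots f_n(X)$ with $n\ge 0$, $f_i\in\{p,s,I,\neg,\exists\}$ and $X$ either $e$ or a relation symbol. Each term $\mathcal{T}$ defines in each model $\mathfrak{A}$ (of a vocabulary containing the relation symbols of $\mathcal{T}$) an AD-relation $\mathcal{T}^{\mathfrak{A}}$ over $A$ of arity $\mathit{ar}(\mathcal{T})$. Let $k=\mathit{ar}(\mathcal{T})$. - $R^{\mathfrak{A}}$ is the interpretation of $R$ in $\mathfrak{A}$, paired with the arity of $R$; $e^{\mathfrak{A}}=(\{(a,a)\mid a\in A\},2)$. - If $k\ge2$: $(p\mathcal{T})^{\mathfrak{A}}=(\{(a_k,a_1,\dots,a_{k-1})\mid(a_1,\dots,a_k)\in\mathcal{T}^{\mathfrak{A}}\},k)$; $(s\mathcal{T})^{\mathfrak{A}}=(\{(a_1,\dots,a_{k-2},a_k,a_{k-1})\mid(a_1,\dots,a_k)\in\mathcal{T}^{\mathfrak{A}}\},k)$;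 $(I\mathcal{T})^{\mathfrak{A}}=(\{(a_1,\dots,a_{k-1})\mid(a_1,\dots,a_k)\in\mathcal{T}^{\mathfrak{A}},\ a_{k-1}=a_k\},k-1)$. If $k\le1$, each of $p\mathcal{T},s\mathcal{T},I\mathcal{T}$ is interpreted as $\mathcal{T}^{\mathfrak{A}}$. - $(\neg\mathcal{T})^{\mathfrak{A}}=(\{t\in A^k\mid t\notin\mathcal{T}^{\mathfrak{A}}\},k)$. - If $k\ge1$: $(\exists\mathcal{T})^{\mathfrak{A}}=(\{(a_1,\dots,a_{k-1})\mid(a_1,\dots,a_k)\in\mathcal{T}^{\mathfrak{A}}\text{ for some }a_k\in A\},k-1)$; if $k=0$: $(\exists\mathcal{T})^{\mathfrak{A}}=\mathcal{T}^{\mathfrak{A}}$. A term $\mathcal{T}$ is satisfiable if there exists a model $\mathfrak{A}$ such that $\mathcal{T}^{\mathfrak{A}}$ is not the empty AD-relation $(\varnothing,\mathit{ar}(\mathcal{T}))$. *)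

(* Defs.v *)
From HB Require Import structures.
From mathcomp Require Import all_boot.
From mathcomp Require Import boolp classical_sets.

Set Implicit Arguments.
Unset Strict Implicit.
Unset Printing Implicit Defensive.

Local Open Scope classical_set_scope.

Record dfa (Sigma : finType) := Dfa {
  state : finType;
  start : state;
  final : pred state;
  step : state -> Sigma -> state }.

Definition dfa_lang (Sigma : finType) (M : dfa Sigma) : set (seq Sigma) :=
  [set w | final (foldl (@step _ M) (start M) w)].

Definition regular (Sigma : finType) (L : set (seq Sigma)) : Prop :=
  exists M : dfa Sigma, L = dfa_lang M.

(* For each arity, the symbols of that arity are indexed by nat. *)
Record relsym := RelSym { sym_arity : nat; sym_index : nat }.

Inductive op := OpP | OpS | OpI | OpNeg | OpEx.

Inductive term :=
  | TE
  | TRel of relsym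
  | TOp of op & term.

Definition op_ar (o : op) (k : nat) : nat :=
  match o with
  | OpP | OpS | OpNeg => k
  | OpI => if k is k'.+2 then k'.+1 else k
  | OpEx => k.-1
  end.

Fixpoint ar (t : term) : nat :=
  match t with
  | TE => 2
  | TRel R => sym_arity R
  | TOp o t' => op_ar o (ar t')
  end.

(* An AD-relation of arity k over A is an element of set (k.-tuple A): the
   arity is recorded in the type, so that empty relations of different arities
   are different objects. *)

Record model := Model {
  voc : set relsym;
  dom : Type;
  dom_nonempty : inhabited dom;
  interp : forall R : relsym, voc R -> set ((sym_arity R).-tuple dom) }.

Definition e_sem (A : Type) : set (2.-tuple A) :=
  [set t | exists a, t = [tuple a; a]].

Definition p_sem (A : Type) (k : nat) :
    set (k.-tuple A) -> set (k.-tuple A) :=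
  match k with
  | k'.+2 => fun R => [set t | exists (u : k'.+1.-tuple A) (a : A),
      R [tuple of rcons u a] /\ t = [tuple of a :: u]]
  | _ => fun R => R
  end.

Definition s_sem (A : Type) (k : nat) :
    set (k.-tuple A) -> set (k.-tuple A) :=
  match k with
  | k'.+2 => fun R => [set t | exists (u : k'.-tuple A) (a b : A),
      R [tuple of rcons (rcons u a) b] /\
      t = [tuple of rcons (rcons u b) a]]
  | _ => fun R => R
  end.

Definition I_sem (A : Type) (k : nat) :
    set (k.-tuple A) -> set ((op_ar OpI k).-tuple A) :=
  match k return
    set (k.-tuple A) -> set ((op_ar OpI k).-tuple A)
  with
  | k'.+2 => fun R => [set t | exists (u : k'.-tuple A) (a : A),
      R [tuple of rcons (rcons u a) a] /\ t = [tuple of rcons u a]]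
  | _ => fun R => R
  end.

Definition ex_sem (A : Type) (k : nat) :
    set (k.-tuple A) -> set ((op_ar OpEx k).-tuple A) :=
  match k return
    set (k.-tuple A) -> set ((op_ar OpEx k).-tuple A)
  with
  | k'.+1 => fun R => [set t : k'.-tuple A | exists a : A,
      R [tuple of rcons t a]]
  | 0 => fun R => R
  end.

Definition op_sem (A : Type) (o : op) (k : nat) :
    set (k.-tuple A) -> set ((op_ar o k).-tuple A) :=
  match o return
    set (k.-tuple A) -> set ((op_ar o k).-tuple A)
  with
  | OpP => @p_sem A k
  | OpS => @s_sem A k
  | OpI => @I_sem A k
  | OpNeg => fun R => ~` R
  | OpEx => @ex_sem A k
  end.

Fixpoint over_voc (V : set relsym) (t : term) : Prop :=
  match t with
  | TE => True
  | TRel R => V R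
  | TOp _ t' => over_voc V t'
  end.

Fixpoint sem (M : model) (t : term) :
    over_voc (voc M) t -> set ((ar t).-tuple (dom M)) :=
  match t with
  | TE => fun _ => @e_sem (dom M)
  | TRel R => fun VR => interp VR
  | TOp o t' => fun Vt => @op_sem (dom M) o (ar t') (@sem M t' Vt)
  end.

Definition satisfiable : set term :=
  [set t | exists (M : model) (Vt : over_voc (voc M) t), sem Vt <> set0].

Definition nat_of_op (o : op) : 'I_5 :=
  match o with
  | OpP => inord 0 | OpS => inord 1 | OpI => inord 2
  | OpNeg => inord 3 | OpEx => inord 4
  end.

Definition op_of_nat (i : 'I_5) : op :=
  nth OpP [:: OpP; OpS; OpI; OpNeg; OpEx] i.

Lemma nat_of_opK : cancel nat_of_op op_of_nat.
Proof. by case; rewrite /op_of_nat /= inordK. Qed.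

HB.instance Definition _ := Finite.copy op (can_type nat_of_opK).

(* The letters are the five operators, the constant e, and the characters of a
   finite alphabet S in which the infinitely many relation symbols are named. *)
Definition letter (S : finType) : finType := (op + unit + S)%type.

(* The term f_1 ... f_n X is written as f_1, ..., f_n followed by the letter e
   or the name of the relation symbol X; as S is disjoint from the other
   letters, this is a faithful encoding whenever code is injective. *)
Fixpoint word (S : finType) (code : relsym -> seq S) (t : term) :
    seq (letter S) :=
  match t with
  | TE => [:: inl (inr tt)]
  | TRel R => [seq inr c | c <- code R]
  | TOp o t' => inl (inl o) :: word code t'
  end.

(* A naming of the relation symbols that is injective and has a regular set of
   names: 1^k 0 1^i for the symbol number i of arity k. *)
Definition unary_code (R : relsym) : seq bool :=
  nseq (sym_arity R) true ++ false :: nseq (sym_index R) true.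

Lemma unary_code_inj : injective unary_code.
Proof.
have nseq_inj m n : nseq m true = nseq n true -> m = n.
  by move=> /(congr1 size); rewrite !size_nseq.
case=> k i [l j]; rewrite /unary_code /=.
elim: k l => [|k IHk] [|l] //= [].
- by move=> /nseq_inj ->.
- by move=> /IHk [-> ->].
Qed.

Lemma unary_code_regular : regular (range unary_code).
Proof.
(* states: None before the 0, Some true after it, Some false a dead end *)
pose d (q : option bool) (c : bool) : option bool :=
  if c then q else if q is None then Some true else Some false.
exists (@Dfa bool (option bool) None (pred1 (Some true)) d).
apply/seteqP; split=> w; rewrite /dfa_lang /=.
  case=> -[k i] _ <-; rewrite /unary_code /= foldl_cat.
  have fixd q n : foldl d q (nseq n true) = q by elim: n.
  by rewrite fixd /= fixd.
have dead v : foldl d (Some false) v = Some false by elim: v => [|[]].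
have tailP v : foldl d (Some true) v == Some true ->
    exists i, v = nseq i true.
  elim: v => [|[] v IHv] /=; first by exists 0.
  - by move=> /IHv [i ->]; exists i.+1.
  - by rewrite dead.
elim: w => [|[] w IHw] //=.
- by move=> /IHw [[k i] _ <-]; exists (RelSym k.+1 i).
- by move=> /tailP [i ->]; exists (RelSym 0 i).
Qed.

(* Main.v *)
Require Import Defs.
From mathcomp Require Import all_boot.
From mathcomp Require Import boolp classical_sets.

(* A term over a relation symbol R is always satisfiable: interpreting R as
   full or as empty, every operator but negation preserves the relation being
   constant, so one of the two choices makes the term full.  A term over e
   denotes equality or inequality as long as its arity is 2, and a full or empty
   relation afterwards; the model only matters for the projection of the
   inequality, which is empty exactly when the domain is a singleton.  The outermost
   operator is read first, so the automaton maintains the set of values that the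
   unread subterm may take for the whole term to be satisfiable. *)

Local Open Scope classical_set_scope.

(** * Operators on constant and on binary relations *)

Lemma tuple_rconsP {A : Type} {k : nat} (t : k.+1.-tuple A) :
  exists (u : k.-tuple A) (a : A), t = [tuple of rcons u a].
Proof.
case: t => s; case/lastP: s => [//|s a] sk.
have sk' : size s == k by rewrite size_rcons eqSS in sk.
by exists (Tuple sk'), a; apply: val_inj.
Qed.

Lemma tuple1P {A : Type} (t : 1.-tuple A) : exists a, t = [tuple a].
Proof.
by case/tupleP: t => a u; exists a; rewrite (tuple0 u); apply: val_inj.
Qed.

Lemma tuple2P {A : Type} (t : 2.-tuple A) : exists a b, t = [tuple a; b].
Proof.
case/tupleP: t => a u; have [b ->] := tuple1P u.
by exists a, b; apply: val_inj.
Qed.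

(** Apart from negation, operators only permute, identify or project coordinates, which cannot
    affect a membership condition that ignores the tuple; a nonempty domain supplies the projected
    coordinate. *)
Lemma op_sem_const {A : Type} (o : op) {k : nat} (P : Prop) : inhabited A ->
  @op_sem A o k [set _ | P] =
  [set _ | if o is OpNeg then ~ P else P].
Proof.
case=> a0; apply/seteqP; split; case: o => //=; case: k => [|[|k]] t //=.
- by case=> u [a [HP]].
- by case=> u [a [b [HP]]].
- by case=> u [a [HP]].
- by case.
- by case.
- by move=> HP; case/tupleP: t => a u; exists u, a.
- move=> HP; have [v [a ->]] := tuple_rconsP t.
  by have [u [b ->]] := tuple_rconsP v; exists u, a, b.
- by move=> HP; have [u [a ->]] := tuple_rconsP t; exists u, a.
Qed.

Section BinaryRelations.
Variables (A : Type) (R : set (2.-tuple A)).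

Lemma p_sem2 a b : p_sem R [tuple a; b] <-> R [tuple b; a].
Proof.
split=> [[u [c [Rt /(congr1 val)]]]|Rba].
  have [d ud] := tuple1P u; subst u => -[-> ->].
  by congr R: Rt; apply: val_inj.
by exists [tuple b], a; split; [congr R: Rba|]; apply: val_inj.
Qed.

Lemma s_sem2 a b : s_sem R [tuple a; b] <-> R [tuple b; a].
Proof.
split=> [[u [c [d [Rt /(congr1 val)]]]]|Rba].
  rewrite (tuple0 u) /= in Rt * => -[-> ->].
  by congr R: Rt; apply: val_inj.
by exists [tuple], b, a; split; [congr R: Rba|]; apply: val_inj.
Qed.

Lemma I_sem2 (a : A) : I_sem R [tuple a] <-> R [tuple a; a].
Proof.
split=> [[u [c [Rt /(congr1 val)]]]|Raa].
  rewrite (tuple0 u) /= in Rt * => -[->].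
  by congr R: Rt; apply: val_inj.
by exists [tuple], a; split; [congr R: Raa|]; apply: val_inj.
Qed.

Lemma ex_sem2 (a : A) : ex_sem R [tuple a] <-> exists b, R [tuple a; b].
Proof. by split=> -[b Rab]; exists b; congr R: Rab; apply: val_inj. Qed.

End BinaryRelations.

(** * Abstract values of relations *)

Definition adrel (A : Type) : Type := {k : nat & set (k.-tuple A)}.

Definition op_adrel {A : Type} (o : op) (R : adrel A) : adrel A :=
  existT _ (op_ar o (projT1 R)) (@op_sem A o _ (projT2 R)).

Definition eq_adrel (A : Type) (b : bool) : adrel A :=
  existT _ 2 [set t | (exists a, t = [tuple a; a]) <-> b].

Definition const_adrel (A : Type) (k : nat) (P : Prop) : adrel A :=
  existT _ k [set _ | P].

Lemma eq_adrel2 (A : Type) (b : bool) (a c : A) :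
  projT2 (eq_adrel A b) [tuple a; c] <-> (a = c <-> b).
Proof.
have diagP : (exists x, [tuple a; c] = [tuple x; x]) <-> a = c.
  by split=> [[x /(congr1 val) [-> ->]]|->] //; exists c.
by rewrite /= (propext diagP).
Qed.

(* [inl b]: equality if b, inequality otherwise.  [inr (b1, b)]: full or empty
   according to b1 over a singleton domain, to b over any other domain. *)
Definition aval : Type := (bool + bool * bool)%type.

Definition op_aval (o : op) (q : aval) : aval :=
  match o, q with
  | OpNeg, inl b => inl (~~ b)
  | OpNeg, inr (b1, b) => inr (~~ b1, ~~ b)
  | OpI, inl b => inr (b, b)
  | OpEx, inl b => inr (b, true)
  | _, _ => q
  end.

Definition sat_aval (q : aval) : bool :=
  if q is inr (b1, b) then b1 || b else true.

(** The arity of a constant relation is left existential: operators keep it constant whatever its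
    arity, so finitely many values suffice. *)
Definition denotes {A : Type} (R : adrel A) (q : aval) : Prop :=
  match q with
  | inl b => R = eq_adrel A b
  | inr (b1, b) => exists k,
      R = const_adrel A k (if `[< forall x y : A, x = y >] then b1 else b)
  end.

Lemma eq_adrelP {A : Type} (R : set (2.-tuple A)) (b : bool) :
  (forall a c, R [tuple a; c] <-> (a = c <-> b)) ->
  existT _ 2 R = eq_adrel A b.
Proof.
move=> Rb; congr existT; apply/seteqP; split=> t; have [a [c ->]] := tuple2P t.
  by move/Rb => ?; apply/eq_adrel2.
by move/eq_adrel2/Rb.
Qed.

Lemma denotes_op {A : Type} (o : op) (R : adrel A) (q : aval) :
  inhabited A -> denotes R q -> denotes (op_adrel o R) (op_aval o q).
Proof.
move=> A0; case: q => [b|[b1 b]] /= => [->|[k ->]]; last first.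
  rewrite /op_adrel /= op_sem_const //.
  case: o => /=; do [by eexists | exists k; congr existT].
  by apply/seteqP; split=> t /=; case: ifP => _ /negP.
(* At arity 2 both [p] and [s] swap the coordinates, and equality and inequality are symmetric. *)
have symE a c : (c = a <-> b) <-> (a = c <-> b).
  by split=> -[h1 h2]; split=> [/esym/h1|/h2/esym].
pose E := projT2 (eq_adrel A b).
case: o => /=.
- apply: (eq_adrelP (@p_sem A 2 E)) => a c.
  by rewrite p_sem2 /E eq_adrel2.
- apply: (eq_adrelP (@s_sem A 2 E)) => a c.
  by rewrite s_sem2 /E eq_adrel2.
- have IE : @I_sem A 2 E = [set _ | b].
    apply/seteqP; split=> t; have [a ->] := tuple1P t;
      rewrite I_sem2 /E eq_adrel2.
      by case=> + _; apply.
    by move=> bT; split.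
  by exists 1; rewrite if_same /const_adrel -IE.
- apply: (eq_adrelP (~` E)) => a c.
  have -> : (a = c <-> ~~ b) <-> ~ (a = c <-> b).
    by case: (b); rewrite /= trueE falseE; have := pselect (a = c); tauto.
  by rewrite -eq_adrel2.
- have exE : @ex_sem A 2 E =
      [set _ | if `[< forall x y : A, x = y >] then b else true]; last first.
    by exists 1; rewrite /const_adrel -exE.
  apply/seteqP; split=> t; have [a ->] := tuple1P t; rewrite ex_sem2.
    case=> c /eq_adrel2 acb /=; case: asboolP => // A1.
    by apply/acb/A1.
  rewrite /=; case: asboolP => [A1 bT|nA1 _].
    by exists a; apply/eq_adrel2.
  rewrite {}/E; case: (b); first by exists a; apply/eq_adrel2.
  (* If every element equalled [a], the domain would be a singleton. *)
  have [c ac] : exists c, a <> c.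
    apply: contrapT => /forallNP ac; apply: nA1 => x y.
    by rewrite -(contrapT (ac x)) -(contrapT (ac y)).
  by exists c; apply/eq_adrel2; split.
Qed.

(** * Satisfiability through abstract values *)

Fixpoint term_aval (t : term) : option aval :=
  match t with
  | TE => Some (inl true)
  | TRel _ => None
  | TOp o t' => omap (op_aval o) (term_aval t')
  end.

Lemma term_avalP (M : model) (t : term) (Vt : over_voc (voc M) t) (q : aval) :
  term_aval t = Some q -> denotes (existT _ (ar t) (sem Vt)) q.
Proof.
elim: t q Vt => //= [|o t IHt] q Vt.
  case=> <-; apply: eq_adrelP => a c.
  split=> [[x /(congr1 val) [-> ->]]|[_ /(_ isT) ->]] //.
  by exists c.
case: term_aval IHt => //= q' IHt [<-].
exact: denotes_op (dom_nonempty M) (IHt _ Vt erefl).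
Qed.

Lemma rel_term_sat (t : term) : term_aval t = None -> satisfiable t.
Proof.
pose M (b : bool) := @Model setT unit (inhabits tt) (fun _ _ => [set _ | b]).
move=> t_rel.
(* [c] is the parity of the number of negations in [t], so the choice [b = ~~ c] makes [t] full. *)
have [c semM] : exists c : bool, forall b (Vt : over_voc (voc (M b)) t),
    sem Vt = [set _ | b (+) c].
  elim: t t_rel => //= [R _|o t IHt].
    by exists false => b _; rewrite addbF.
  case: term_aval IHt => // /(_ erefl) [c semM] _.
  exists (c (+) (if o is OpNeg then true else false)) => b Vt.
  rewrite semM op_sem_const; last exact: inhabits tt.
  case: o {Vt}; rewrite ?addbF // addbT addbN.
  by apply/seteqP; split=> t' /= /negP.
have Vt : over_voc (voc (M (~~ c))) t by elim: (t).
exists (M (~~ c)), Vt; rewrite semM => /seteqP [/(_ [tuple of nseq _ tt])].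
by case: (c) => /(_ isT).
Qed.

Lemma denotes_sat {A : Type} (R : adrel A) (q : aval) :
  denotes R q -> projT2 R !=set0 -> sat_aval q.
Proof.
case: q => //= -[b1 b] [k ->] [t] /=.
by case: ifP => _ -> //; rewrite orbT.
Qed.

(** Domains with one and two elements represent both cases; two elements provide an equal and an
    unequal pair. *)
Lemma sat_denotes (q : aval) : sat_aval q ->
  exists A : Type, inhabited A /\
    forall R : adrel A, denotes R q -> projT2 R !=set0.
Proof.
case: q => [b _|[[] b] /= bT].
- exists bool; split; first exact: inhabits true.
  by move=> R ->; exists [tuple true; b]; apply/eq_adrel2; case: b.
- exists unit; split; first exact: inhabits tt.
  move=> R [k ->]; exists [tuple of nseq k tt] => /=.
  by case: asboolP => // -[]; case=> -[].
- exists bool; split; first exact: inhabits true.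
  move=> R [k ->]; exists [tuple of nseq k true] => /=.
  by case: asboolP => // /(_ true false).
Qed.

Lemma term_sat (t : term) : satisfiable t <-> oapp sat_aval true (term_aval t).
Proof.
case tq: (term_aval t) => [q|]; last by split=> // _; exact: rel_term_sat.
split=> [[M [Vt /eqP/set0P]]|/sat_denotes [A [A0 ne]]].
  exact: denotes_sat _ _ (term_avalP _ _ Vt _ tq).
pose M := @Model setT A A0 (fun _ _ => set0).
have Vt : over_voc (voc M) t by elim: (t).
by exists M, Vt; apply/eqP/set0P; exact: ne _ (term_avalP _ _ Vt _ tq).
Qed.

(** * The automaton and its correctness *)

Section TermAutomaton.
Variables (S : finType) (code : relsym -> seq S) (N : dfa S).
Hypothesis codeN : range code = dfa_lang N.

(* [inl F]: operators are being read, and F is the set of admissible values of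
   the remaining subterm; [inr (inl b)]: e has been read, with verdict b, a
   dead end being a negative verdict; [inr (inr n)]: a relation symbol is being
   read, and N is in state n.  As names may be empty, a word may end in [inl F]
   as well. *)
Definition term_state : finType :=
  ({ffun aval -> bool} + (bool + state N))%type.

(** Reading an operator [o] replaces [F] by its preimage under [op_aval o]. *)
Definition term_step (x : term_state) (c : letter S) : term_state :=
  match x, c with
  | inl F, inl (inl o) => inl [ffun q => F (op_aval o q)]
  | inl F, inl (inr tt) => inr (inl (F (inl true)))
  | inl _, inr a => inr (inr (step (start N) a))
  | inr (inr n), inr a => inr (inr (step n a))
  | _, _ => inr (inl false)
  end.

Definition term_final (x : term_state) : bool :=
  match x with
  | inl _ => final (start N)
  | inr (inl b) => b
  | inr (inr n) => final n
  end.

Lemma term_run_verdict (b : bool) (w : seq (letter S)) :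
  term_final (foldl term_step (inr (inl b)) w) <-> b /\ w = [::].
Proof.
have dead v : foldl term_step (inr (inl false)) v = inr (inl false) by elim: v.
by case: w => [|c w] /=; [split=> [|[]]|rewrite dead; split=> // -[]].
Qed.

Lemma term_run_name (n : state N) (w : seq (letter S)) :
  term_final (foldl term_step (inr (inr n)) w) <->
  exists2 u, w = [seq inr a | a <- u] & final (foldl (@step _ N) n u).
Proof.
elim: w n => [|[c|a] w IHw] n /=.
- by split=> [nF|[[|//] _]]; first by exists [::].
- by rewrite (term_run_verdict false w); split=> [[]|[[]]].
- rewrite IHw; split=> [[u -> uF]|[[//|a' u] [-> ->] uF]]; last by exists u.
  by exists (a :: u).
Qed.

(** Keeping [F] general lets the induction peel off one operator at a time; terms over a relation
    symbol are admissible for every [F]. *)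
Lemma term_runP (F : {ffun aval -> bool}) (w : seq (letter S)) :
  term_final (foldl term_step (inl F) w) <->
  exists2 t, oapp F true (term_aval t) & word code t = w.
Proof.
have nameP u : final (foldl (@step _ N) (start N) u) <-> range code u.
  by rewrite codeN.
elim: w F => [|[[o|[]]|a] w IHw] F /=.
- rewrite (nameP [::]); split=> [[R _ Ru]|[[|R|//] //= _]].
    by exists (TRel R) => //=; rewrite Ru.
  by case Ru: (code R) => // _; exists R.
(* The first letter is an operator, hence not a character of a name, so only a compound term can be
   encoded. *)
- rewrite IHw; split=> [[t tF <-]|[[|R|o' t] //= tF]].
  + exists (TOp o t) => //=; case: term_aval tF => //= q.
    by rewrite ffunE.
  + by case: (code R).
  + case=> <- <-; exists t => //; case: term_aval tF => //= q.
    by rewrite ffunE.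
- rewrite term_run_verdict; split=> [[Ft ->]|[[|R|//] //= Ft]].
  + by exists TE.
  + by case=> <-.
  + by case: (code R).
- rewrite term_run_name; split=> [[u -> /(nameP (a :: u)) [R _ Ru]]|].
    by exists (TRel R) => //=; rewrite Ru.
  case=> -[|R|//] //= _; case Ru: (code R) => [//|a' u] [<- <-].
  by exists u => //; apply/(nameP (a' :: u)); exists R.
Qed.

End TermAutomaton.

Theorem theorem5p5 (S : finType) (code : relsym -> seq S)
    (code_inj : injective code) (code_reg : regular (range code)) :
  regular [set word code t | t in satisfiable].
Proof.
case: code_reg => N codeN.
exists (Dfa (inl [ffun q => sat_aval q]) (@term_final S N) (@term_step S N)).
have satE t : oapp [ffun q => sat_aval q] true (term_aval t) <-> satisfiable t.
  by rewrite term_sat; case: term_aval => //= q; rewrite ffunE.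
apply/seteqP; split=> w.
  move=> [t t_sat <-]; apply/(term_runP _ _ _ codeN).
  by exists t => //; apply/satE.
by move/(term_runP _ _ _ codeN) => [t /satE]; exists t.
Qed.
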